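(* Let $X_1,\dots,X_n$ be i.i.d. random variables with an arbitrary distribution $P^0$ on a measurable space $(\mathbb{X},\mathcal{X})$ (not necessarily belonging to any model), and consider a countable collection of models $\mathcal{M}_K=\{P_{\theta_K}:\theta_K\in\Theta_K\}$, $K\ge1$, with prior, variational sets, variational approximations $\tilde\pi^K_{n,\alpha}(\cdot|X_1^n)$ and selected index $\hat K$ as in the context. For each $K$ let $r_{K,n}>0$ and let $\Theta_K(r_{K,n})$ be the set of $\theta^*_K\in\Theta_K$ for which there exists $\rho_{K,n}\in\mathcal{F}_K$ with $$\int\mathbb{E}\Big[\log\frac{P_{\theta^*_K}(X_i)}{P_{\theta_K}(X_i)}\Big]\rho_{K,n}(d\theta_K)\le r_{K,n}\quad\text{and}\quad\mathrm{KL}(\rho_{K,n},\Pi_K)\le n r_{K,n}.$$ Then for any $\alpha\in(0,1)$, $$\mathbb{E}\Big[\int D_\alpha(P_\theta,P^0)\,\tilde\pi^{\hat K}_{n,\alpha}(d\theta|X_1^n)\Big]\le\inf_{K\ge1}\Big\{\frac{\alpha}{1-\alpha}\inf_{\theta^*_K\in\Theta_K(r_{K,n})}\mathrm{KL}(P^0,P_{\theta^*_K})+\frac{1+\alpha}{1-\alpha}r_{K,n}+\frac{\log(1/\pi_K)}{n(1-\alpha)}\Big\}.$$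
   Context: All expectations are with respect to $X_1,\dots,X_n$ i.i.d. $\sim P^0$ (so $\mathbb{E}[\log(P_{\theta^*_K}(X_i)/P_{\theta_K}(X_i))]$ does not depend on $i$; $P_\theta(x)$ denotes densities w.r.t. a common dominating measure). Models: for each $K\ge1$, $\Theta_K$ is a parameter set and $\mathcal{M}_K=\{P_{\theta_K}:\theta_K\in\Theta_K\}$ a family of probability distributions on $\mathbb{X}$. Prior: weights $\pi_K>0$ with $\sum_K\pi_K=1$ and conditional priors $\Pi_K$ on $\Theta_K$; $\pi=\sum_K\pi_K\Pi_K$. Likelihood $L_n(\theta_K)=\prod_{i=1}^nP_{\theta_K}(X_i)$, $\ell_n=\log L_n$. For $\alpha\in(0,1)$, the tempered posterior is $\pi^K_{n,\alpha}(d\theta_K|X_1^n)\propto L_n(\theta_K)^\alpha\Pi_K(d\theta_K)$. For each $K$, $\mathcal{F}_K$ is a given set of probability distributions on $\Theta_K$ and $\tilde\pi^K_{n,\alpha}(\cdot|X_1^n)=\arg\min_{\rho_K\in\mathcal{F}_K}\mathrm{KL}(\rho_K,\pi^K_{n,\alpha}(\cdot|X_1^n))=\arg\max_{\rho_K\in\mathcal{F}_K}\{\alpha\int\ell_n d\rho_K-\mathrm{KL}(\rho_K,\Pi_K)\}$. $\mathrm{ELBO}(K)=\alpha\int\ell_n(\theta_K)\tilde\pi^K_{n,\alpha}(d\theta_K|X_1^n)-\mathrm{KL}(\tilde\pi^K_{n,\alpha}(\cdot|X_1^n),\Pi_K)$ and $\hat K=\arg\max_{K\ge1}\{\mathrm{ELBO}(K)-\log(1/\pi_K)\}$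 (optimizers assumed to exist). $\mathrm{KL}(P,R)=\int\log(dP/dR)dP$ if $P\ll R$, $+\infty$ otherwise; $D_\alpha(P,R)=\frac1{\alpha-1}\log\int(dP/dR)^{\alpha-1}dP$ if $P\ll R$, $+\infty$ otherwise.
   Formalization: D_α is taken as (1/(α−1)) log ∫p^α r^{1−α}dμ, not +∞ whenever P is not ≪ R (the bound fails then, e.g. P⁰ uniform, Gaussian model); P⁰ is assumed to have a density w.r.t. the dominating measure (otherwise the bound is infinite), and implicit measurability is assumed. *)

(* Defs.v *)
From HB Require Import structures.
From mathcomp Require Import all_boot all_order all_algebra.
From mathcomp Require Import all_classical all_reals all_analysis.
From mathcomp Require Import measurable_realfun.
Set Implicit Arguments. Unset Strict Implicit. Unset Printing Implicit Defensive.
Import Order.TTheory GRing.Theory Num.Theory numFieldNormedType.Exports.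
Local Open Scope classical_set_scope.
Local Open Scope ring_scope.

Section defs.
Context {R : realType}.
Local Open Scope ereal_scope.

Definition elog (x : R) : \bar R := if (0 < x)%R then (ln x)%:E else -oo.

Definition KLm d (T : measurableType d) (rho Pi : probability T R) : \bar R :=
  if pselect (rho `<< Pi) then
    \int[rho]_t (ln (fine (Radon_Nikodym (charge_of_finite_measure rho) Pi t)))%:E
  else +oo.

Definition dens_abs_cont d (T : measurableType d) (mu : {measure set T -> \bar R})
  (p q : T -> R) : Prop :=
  forall A, measurable A -> \int[mu]_(x in A) (q x)%:E = 0 ->
    \int[mu]_(x in A) (p x)%:E = 0.

(* KL(P, Q) for P, Q with mu-densities p, q: \int log(dP/dQ) dP = \int p log(p/q) dmu *)
Definition KLdens d (T : measurableType d) (mu : {measure set T -> \bar R})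
  (p q : T -> R) : \bar R :=
  if pselect (dens_abs_cont mu p q) then
    \int[mu]_x ((p x)%:E * elog (p x / q x))
  else +oo.

(* Renyi divergence of order alpha in (0,1) between P, Q with mu-densities p, q:
   D_alpha(P,Q) = 1/(alpha-1) log \int p^alpha q^(1-alpha) dmu  (+oo if the
   integral vanishes, i.e. P and Q are mutually singular). *)
Definition Dalpha d (T : measurableType d) (mu : {measure set T -> \bar R})
  (alpha : R) (p q : T -> R) : \bar R :=
  let H := \int[mu]_x ((p x `^ alpha) * (q x `^ (1 - alpha)))%:E in
  if H == 0 then +oo else ((ln (fine H)) / (alpha - 1))%:E.

Definition iid_sample d dO (TX : measurableType d) (Omega : measurableType dO)
  (Pr : probability Omega R) (n : nat) (X : 'I_n -> Omega -> TX)
  (P0 : probability TX R) : Prop :=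
  [/\ (forall i, measurable_fun setT (X i)),
      (forall i A, measurable A -> Pr (X i @^-1` A) = P0 A) &
      (forall A : 'I_n -> set TX, (forall i, measurable (A i)) ->
        Pr (\bigcap_(i in [set: 'I_n]) (X i @^-1` A i)) =
        \prod_(i < n) Pr (X i @^-1` A i))].

Definition loglik d (TX : measurableType d) (Th : Type) (dens : Th -> TX -> R)
  (n : nat) (xs : 'I_n -> TX) (th : Th) : \bar R :=
  \sum_(i < n) elog (dens th (xs i)).

Definition elbo_obj d dT (TX : measurableType d) (Th : measurableType dT)
  (dens : Th -> TX -> R) (Pi : probability Th R) (alpha : R)
  (n : nat) (xs : 'I_n -> TX) (rho : probability Th R) : \bar R :=
  alpha%:E * \int[rho]_th loglik dens xs th - KLm rho Pi.

Definition Theta_r d dT (TX : measurableType d) (Th : measurableType dT)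
  (dens : Th -> TX -> R) (P0 : probability TX R) (Pi : probability Th R)
  (F : set (probability Th R)) (n : nat) (r : R) : set Th :=
  [set ths | exists rho, F rho /\
     \int[rho]_th (\int[P0]_x (elog (dens ths x) - elog (dens th x))) <= r%:E /\
     KLm rho Pi <= (n%:R * r)%:E].

End defs.

(* Main.v *)
Require Import Defs.
From HB Require Import structures.
From mathcomp Require Import all_boot all_order all_algebra.
From mathcomp Require Import all_classical all_reals all_analysis.
From mathcomp Require Import measurable_realfun.
From mathcomp Require Import ring lra.
Import Order.TTheory GRing.Theory Num.Theory numFieldNormedType.Exports.
Local Open Scope classical_set_scope.
Local Open Scope ring_scope.
Local Open Scope ereal_scope.

(** Put W_K(w, th) := prod_i (p_th / p0)^alpha (X_i) * exp (n (1 - alpha) D_alpha(P_th, P0)).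
    By independence, E[W_K(., th)] <= 1, so the mixture
    Z := sum_K pi_K * int W_K dPi_K satisfies E[Z] <= 1. With f := drho/dPi_K, the
    inequality ln y <= y - 1 at y = pi_K W_K / f, integrated against rho, gives
      n (1 - alpha) int D_alpha drho + alpha int ln (L_n / L_n^0) drho
        - KL(rho, Pi_K) - ln (1 / pi_K) <= Z - 1,
    where L_n^0 is the likelihood of p0. Apply this to the selected variational
    approximation: the terms other than D_alpha are its penalised ELBO, which may
    be replaced by the smaller one of the rho witnessing that ths lies in
    Theta_K(r_K). Taking expectations, Z - 1 drops out and Fubini bounds
    the expectation of int ln (p0 / p_th)(X_i) drho by KL(P0, P_ths) + r_K.

    Finiteness of KL(P0, P_ths) is what makes all log-ratios integrable: their
    negative parts are dominated by p_th / p0, of P0-integral at most 1. *)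

(** * Change of variables for weighted image measures *)

Section weighted_transfer.
Context d1 d2 (S : measurableType d1) (T : measurableType d2) (R : realType).
Variables (m : {measure set S -> \bar R}) (nu : {measure set T -> \bar R}).
Variables (Y : S -> R) (phi : S -> T) (c : R).
Hypotheses (Y0 : forall s, (0 <= Y s)%R) (mY : measurable_fun setT Y).
Hypothesis mphi : measurable_fun setT phi.
Hypothesis hA : forall A, measurable A ->
  \int[m]_s (Y s * \1_A (phi s))%:E = c%:E * nu A.

Import HBNNSimple.

(** Equality on indicators extends to simple functions by linearity and to [g] by monotone
    convergence. Three situations share this form: a density ([phi] the identity), the law of [X i]
    ([Y] constant 1), and independence ([Y] the product of the other factors, [c] its
    expectation). *)
Lemma ge0_integral_weighted_comp (g : T -> \bar R) :
  (forall t, 0 <= g t) -> measurable_fun setT g ->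
  \int[m]_s ((Y s)%:E * g (phi s)) = c%:E * \int[nu]_t g t.
Proof.
move=> g0 mg.
pose h := nnsfun_approx measurableT mg.
have hcvg t : (h n t)%:E @[n --> \oo] --> g t by exact: cvg_nnsfun_approx.
have mhphi n : measurable_fun setT (fun s => h n (phi s)).
  by apply: measurableT_comp.
have -> : c%:E * \int[nu]_t g t = limn (fun n => c%:E * \int[nu]_t (h n t)%:E).
  apply/esym/cvg_lim => //; apply: cvgeZl => //.
  rewrite [X in _ --> X](_ : _ = \int[nu]_t limn (fun n => (h n t)%:E)).
    apply: cvg_monotone_convergence => //.
    - by move=> n; exact/measurable_EFinP.
    - by move=> n x _; rewrite lee_fin.
    - by move=> x _ a b ab; rewrite lee_fin; exact/lefP/nd_nnsfun_approx.
  by apply: eq_integral => t _; apply/esym/cvg_lim.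
have -> : \int[m]_s ((Y s)%:E * g (phi s)) =
    limn (fun n => \int[m]_s (Y s * h n (phi s))%:E).
  rewrite -monotone_convergence//.
  - apply: eq_integral => s _; apply/esym/cvg_lim => //.
    under eq_fun do rewrite EFinM.
    exact: cvgeZl.
  - by move=> n; apply/measurable_EFinP; exact: measurable_funM.
  - by move=> n s _; rewrite lee_fin mulr_ge0.
  - move=> s _ a b ab; rewrite lee_fin ler_wpM2l//.
    exact/lefP/nd_nnsfun_approx.
congr (limn _); apply/funext => n.
have mi r : measurable (h n @^-1` [set r]) by [].
have mip r : measurable_fun setT (fun s => \1_(h n @^-1` [set r]) (phi s) : R).
  by apply: measurableT_comp => //; exact: measurable_indic.
have -> : \int[nu]_t (h n t)%:E =
    \sum_(r \in range (h n)) r%:E * nu (h n @^-1` [set r]).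
  by rewrite integralT_nnsfun sintegralE.
rewrite ge0_mule_fsumr//; last first.
  move=> r; case: (pselect (0 <= r)%R) => r0; first by rewrite mule_ge0.
  rewrite preimage_nnfun0 ?measure0 ?mule0//.
  by move/negP : r0; rewrite -ltNge.
transitivity (\int[m]_s (\sum_(r \in range (h n))
    (r%:E * (Y s * \1_(h n @^-1` [set r]) (phi s))%:E))).
  apply: eq_integral => s _.
  rewrite [in LHS]fimfunE EFinM -fsumEFin// ge0_mule_fsumr//; last first.
    by move=> r; exact: nnfun_muleindic_ge0.
  by apply: eq_fsbigr => r _; rewrite -!EFinM mulrCA.
rewrite ge0_integral_fsum//; last 2 first.
- move=> r; apply: emeasurable_funM => //; apply/measurable_EFinP.
  exact: measurable_funM.
- move=> r s _; rewrite -EFinM mulrCA EFinM mule_ge0 ?lee_fin//.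
  by have := nnfun_muleindic_ge0 (h n) r (phi s); rewrite lee_fin.
apply: eq_fsbigr => r; rewrite inE => -[t _ <-].
rewrite ge0_integralZl//; last 3 first.
- by apply/measurable_EFinP; exact: measurable_funM.
- by move=> s _; rewrite lee_fin mulr_ge0.
- by rewrite lee_fin.
by rewrite hA// muleCA.
Qed.

End weighted_transfer.

Section weighted_signed.
Context d1 d2 (S : measurableType d1) (T : measurableType d2) (R : realType).
Variables (m : {measure set S -> \bar R}) (nu : {measure set T -> \bar R}).
Variables (Y : S -> R) (phi : S -> T).
Hypotheses (Y0 : forall s, (0 <= Y s)%R) (mY : measurable_fun setT Y).
Hypotheses (mphi : measurable_fun setT phi).
Hypothesis hA : forall A, measurable A ->
  \int[m]_s (Y s * \1_A (phi s))%:E = nu A.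

Lemma ge0_integral_weighted_comp1 (g : T -> \bar R) :
  (forall t, 0 <= g t) -> measurable_fun setT g ->
  \int[m]_s ((Y s)%:E * g (phi s)) = \int[nu]_t g t.
Proof.
move=> g0 mg; rewrite (@ge0_integral_weighted_comp _ _ _ _ _ m nu Y phi 1)//.
  by rewrite mul1e.
by move=> A mA; rewrite mul1e hA.
Qed.

(** Multiplication by [Y s >= 0] commutes with positive and negative parts, so both sides are the
    same difference of extended reals, even when it reads [+oo - +oo]. *)
Lemma integral_weighted_comp (g : T -> \bar R) : measurable_fun setT g ->
  \int[m]_s ((Y s)%:E * g (phi s)) = \int[nu]_t g t.
Proof.
move=> mg; rewrite integralE [RHS]integralE.
rewrite (eq_integral (fun s => (Y s)%:E * g^\+ (phi s))); last first.
  by move=> s _; rewrite !funeposE maxe_pMr ?mule0// lee_fin.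
rewrite [X in _ - X](eq_integral (fun s => (Y s)%:E * g^\- (phi s))); last first.
  by move=> s _; rewrite !funenegE maxe_pMr ?mule0 ?muleN// lee_fin.
rewrite !ge0_integral_weighted_comp1//.
  exact: measurable_funeneg.
exact: measurable_funepos.
Qed.

Lemma integrable_weighted_comp (g : T -> \bar R) : nu.-integrable setT g ->
  m.-integrable setT (fun s => (Y s)%:E * g (phi s)).
Proof.
move=> /integrableP[mg gi]; apply/integrableP; split.
  apply: emeasurable_funM; first exact/measurable_EFinP.
  exact: measurableT_comp.
under eq_integral do rewrite abseM gee0_abs ?lee_fin//.
rewrite (ge0_integral_weighted_comp1 (abse \o g))//=.
exact: measurableT_comp.
Qed.

End weighted_signed.

(** * Integrability from one-sided bounds *)

Section quasi_integrable.
Context d (T : measurableType d) (R : realType).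
Variables (m : {measure set T -> \bar R}) (f : T -> \bar R).
Hypothesis mf : measurable_fun setT f.

Lemma integrable_posneg_lty : \int[m]_x f^\+ x < +oo ->
  \int[m]_x f^\- x < +oo -> m.-integrable setT f.
Proof.
move=> fp fn; apply/integrableP; split=> //.
under eq_integral do rewrite -/((abse \o f) _) fune_abse.
rewrite ge0_integralD//; last 2 first.
- exact: measurable_funepos.
- exact: measurable_funeneg.
by rewrite lte_add_pinfty.
Qed.

Lemma integrable_neg_lty : \int[m]_x f^\- x < +oo ->
  \int[m]_x f x < +oo -> m.-integrable setT f.
Proof.
move=> fn; rewrite integralE => fi; apply: integrable_posneg_lty => //.
have n0 : 0 <= \int[m]_x f^\- x by exact: integral_ge0.
case: (\int[m]_x f^\- x) fi n0 fn => [n| |]//= fi n0 _.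
rewrite ltey; apply/eqP => fpE; by rewrite fpE in fi.
Qed.

(** Since [+oo - +oo] is [-oo] by convention, an infinite negative part always forces the integral
    to be [-oo]. *)
Lemma integral_neg_lty : -oo < \int[m]_x f x -> \int[m]_x f^\- x < +oo.
Proof.
rewrite integralE => fi; rewrite ltey; apply/eqP => fnE; move: fi.
by rewrite fnE /= addeNy ltxx.
Qed.

End quasi_integrable.

(** * Integrals of products over an i.i.d. sample *)

Section independence.
Context {R : realType} {d dO : measure_display}.
Context {TX : measurableType d} {Omega : measurableType dO}.
Variables (Pr : probability Omega R) (n : nat) (X : 'I_n -> Omega -> TX).
Variable P0 : probability TX R.
Hypothesis iidX : iid_sample Pr X P0.

Let mX i : measurable_fun setT (X i). Proof. by case: iidX. Qed.

(* The indicators are replaced one factor at a time: once the other factors are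
   fixed, the left-hand side is a measure in the set indexing the remaining one. *)
Lemma iid_integral_prod_indic k (phi : 'I_n -> TX -> R) (e : 'I_n -> R) :
  (k <= n)%N ->
  (forall i x, 0 <= phi i x)%R -> (forall i, measurable_fun setT (phi i)) ->
  (forall i, \int[P0]_x (phi i x)%:E = (e i)%:E) ->
  (forall i : 'I_n, (k <= i)%N -> exists2 A, measurable A & phi i = \1_A) ->
  \int[Pr]_w (\prod_(i < n) phi i (X i w))%:E = (\prod_(i < n) e i)%:E.
Proof.
elim: k phi e => [|k ih] phi e kn phi0 mphi he indk.
  (* All factors are indicators here: their product is the indicator of an intersection, and the
     product rule of [iid_sample] applies. *)
  have /boolp.choice[A HA] : forall i, exists B : set TX,
      measurable B /\ phi i = \1_B.
    by move=> i; have [B mB HB] := indk i (leq0n _); exists B.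
  transitivity (Pr (\bigcap_(i in [set: 'I_n]) (X i @^-1` A i))).
    rewrite -[X in _ = Pr X]setIT -integral_indic//; last first.
      apply: fin_bigcap_measurable => // i _; rewrite -[_ @^-1` _]setTI.
      by apply: mX => //; have [] := HA i.
    apply: eq_integral => w _; congr EFin.
    under eq_bigr do rewrite (HA _).2.
    rewrite [RHS]indicE; case: (boolP (w \in _)) => [|].
      rewrite inE => wA; rewrite big1// => i _; rewrite indicE mem_set//.
      exact: wA.
    rewrite notin_setE => wA.
    have [i wi] : exists i, ~ A i (X i w).
      by apply/existsNP => wA'; apply: wA => i _; exact: wA'.
    by rewrite (bigD1 i)//= indicE memNset// mul0r.
  case: iidX => _ hP ->; last by move=> i; have [] := HA i.
  rewrite -prodEFin; apply: eq_bigr => i _.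
  rewrite hP; last by have [] := HA i.
  rewrite -he (HA i).2 integral_indic ?setIT//; by have [] := HA i.
pose j := Ordinal kn.
pose Y w := (\prod_(i < n | i != j) phi i (X i w))%R.
pose c := (\prod_(i < n | i != j) e i)%R.
have -> : (\prod_(i < n) e i)%:E = c%:E * \int[P0]_x (phi j x)%:E.
  by rewrite he -EFinM mulrC /c (bigD1 j).
have -> : \int[Pr]_w (\prod_(i < n) phi i (X i w))%:E =
    \int[Pr]_w ((Y w)%:E * (phi j (X j w))%:E).
  by apply: eq_integral => w _; rewrite -EFinM mulrC /Y (bigD1 j).
apply: (@ge0_integral_weighted_comp _ _ _ _ _ Pr P0 Y (X j) c).
- by move=> w; apply: prodr_ge0.
- rewrite /Y; under eq_fun do rewrite big_mkcond/=.
  apply: measurable_prod => i _; case: (i != j) => //.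
  by apply: measurableT_comp.
- exact: mX.
- move=> A mA.
  (* Testing coordinate [j], of index [k], on a set [A] turns every factor of index at least [k]
     into an indicator, as the induction hypothesis demands. *)
  pose phi' i := if i == j then \1_A else phi i.
  pose e' i := if i == j then fine (P0 A) else e i.
  transitivity (\int[Pr]_w (\prod_(i < n) phi' i (X i w))%:E).
    apply: eq_integral => w _; congr EFin.
    rewrite (bigD1 j)//= [in RHS]mulrC {2}/phi' eqxx; congr (_ * _)%R.
    by apply: eq_bigr => i /negPf ij; rewrite /phi' ij.
  rewrite (ih phi' e').
  + rewrite (bigD1 j)//= {1}/e' eqxx mulrC EFinM fineK ?fin_num_measure//.
    by congr (EFin _ * _); apply: eq_bigr => i /negPf ij; rewrite /e' ij.
  + exact: ltnW.
  + by move=> i x; rewrite /phi'; case: ifP.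
  + by move=> i; rewrite /phi'; case: ifP => // _; exact: measurable_indic.
  + move=> i; rewrite /phi' /e'; case: ifP => // _.
    by rewrite integral_indic// setIT fineK// fin_num_measure.
  + move=> i ki; rewrite /phi'; case: eqP => [ij|ij]; first by exists A.
    apply: indk; rewrite ltn_neqAle ki andbT; apply/eqP => kE; apply: ij.
    exact/val_inj.
- by move=> x; rewrite lee_fin.
- exact/measurable_EFinP.
Qed.

Lemma iid_integral_prod (phi : TX -> R) (e : R) :
  (forall x, 0 <= phi x)%R -> measurable_fun setT phi ->
  \int[P0]_x (phi x)%:E = e%:E ->
  \int[Pr]_w (\prod_(i < n) phi (X i w))%:E = (e ^+ n)%:E.
Proof.
move=> phi0 mphi he.
rewrite (@iid_integral_prod_indic n (fun=> phi) (fun=> e))//.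
  by rewrite prodr_const card_ord.
by move=> i; rewrite leqNgt ltn_ord.
Qed.

Let hX i A : measurable A ->
  \int[Pr]_w (cst 1%R w * \1_A (X i w))%:E = P0 A.
Proof.
move=> mA; case: iidX => _ /(_ i _ mA) <- _.
have mXA : measurable (X i @^-1` A) by rewrite -[_ @^-1` _]setTI; exact: mX.
rewrite -[X in _ = Pr X]setIT -integral_indic//.
by apply: eq_integral => w _; rewrite mul1r.
Qed.

Lemma iid_integral i (g : TX -> \bar R) : measurable_fun setT g ->
  \int[Pr]_w g (X i w) = \int[P0]_x g x.
Proof.
move=> mg; rewrite -(@integral_weighted_comp _ _ _ _ _ Pr P0 (cst 1%R) (X i))//.
  by apply: eq_integral => w _; rewrite mul1e.
exact: hX.
Qed.

Lemma iid_integrable i (g : TX -> \bar R) : P0.-integrable setT g ->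
  Pr.-integrable setT (fun w => g (X i w)).
Proof.
move=> ig.
have := @integrable_weighted_comp _ _ _ _ _ Pr P0 (cst 1%R) (X i)
  (fun=> ler01) (measurable_cst _) (mX i) (hX i) _ ig.
by apply: eq_integrable => // w _; rewrite mul1e.
Qed.

Lemma iid_ae i (Q : TX -> Prop) : {ae P0, forall x, Q x} ->
  {ae Pr, forall w, Q (X i w)}.
Proof.
move=> [N [mN N0 QN]]; exists (X i @^-1` N); split.
- by rewrite -[_ @^-1` _]setTI; exact: mX.
- by case: iidX => _ -> .
- by move=> w /= ?; exact: QN.
Qed.

End independence.

(** * Measurability of logarithm and inverse, and a Young inequality *)

Lemma measurable_elog (R : realType) : measurable_fun setT (@elog R).
Proof.
rewrite /elog; apply: measurable_fun_ifT => //.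
- exact: measurable_fun_ltr.
- by apply/measurable_EFinP; exact: measurable_ln.
Qed.

(** On each half-line the inverse is, up to signs, the real power of exponent -1; at 0 both take the
    value 0. *)
Lemma measurable_inv (R : realType) : measurable_fun setT (@GRing.inv R).
Proof.
have -> : @GRing.inv R = fun x => if (0 <= x)%R then (x `^ (-1))%R else (- (- x) `^ (-1))%R.
  apply/funext => x; case: ifPn => x0; first by rewrite powR_inv1.
  by rewrite powR_inv1 ?invrN ?opprK// oppr_ge0 ltW// ltNge.
apply: measurable_fun_ifT.
- exact: measurable_fun_ler.
- exact: measurable_powR.
- apply: measurable_funN.
  by apply: (measurableT_comp (measurable_powR (-1)%R)); exact: oppr_measurable.
Qed.

Lemma measurable_funV d (T : measurableType d) (R : realType) (D : set T)
  (f : T -> R) : measurable_fun D f -> measurable_fun D (fun x => (f x)^-1)%R.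
Proof. by move=> mf; apply: measurableT_comp => //; exact: measurable_inv. Qed.

(** Young's inequality with conjugate exponents [a^-1] and [(1 - a)^-1], applied to the product of
    the [a]-th power of [x] with 1. *)
Lemma powR_le_affine (R : realType) (a x : R) : (0 < a < 1)%R -> (0 <= x)%R ->
  (x `^ a <= a * x + (1 - a))%R.
Proof.
move=> /andP[a0 a1] x0.
have a1' : (0 < 1 - a)%R by rewrite subr_gt0.
have := @conjugate_powR R (x `^ a)%R 1%R (a^-1)%R ((1 - a)^-1)%R.
rewrite !invrK mulr1 powR1 mul1r -powRrM divff ?gt_eqF// powRr1// mulrC.
by apply; rewrite ?powR_ge0 ?invr_ge0 ?ltW ?invr_gt0// subrKC.
Qed.

(** * Likelihood ratios, affinity and Renyi divergence *)

Section density.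
Context {R : realType} {d : measure_display} {TX : measurableType d}.
Variables (mu : {measure set TX -> \bar R}) (P0 : probability TX R).
Variable p0 : TX -> R.
Hypotheses (p00 : forall x, (0 <= p0 x)%R) (mp0 : measurable_fun setT p0).
Hypothesis P0E : forall A, measurable A -> P0 A = \int[mu]_(x in A) (p0 x)%:E.

Let P0_weight A : measurable A -> \int[mu]_x (p0 x * \1_A x)%:E = P0 A.
Proof.
move=> mA; rewrite P0E// [RHS]integral_mkcond; apply: eq_integral => x _.
by rewrite epatch_indic EFinM.
Qed.

Lemma integral_density g : measurable_fun setT g ->
  \int[P0]_x g x = \int[mu]_x ((p0 x)%:E * g x).
Proof.
by move=> mg; rewrite (@integral_weighted_comp _ _ _ _ _ mu P0 p0 id).
Qed.

Lemma ae_density_gt0 : {ae P0, forall x, (0 < p0 x)%R}.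
Proof.
have mN : measurable [set x | p0 x = 0%R].
  by rewrite -[X in measurable X]setTI;
  exact: (mp0 measurableT [set 0%R] (measurable_set1 0%R)).
exists [set x | p0 x = 0%R]; split => //.
  rewrite P0E//; apply: integral0_eq => x /= ->//.
by move=> x /= /negP; rewrite -leNgt => p0x; apply/le_anti; rewrite p0x p00.
Qed.

Section other.
Variable q : TX -> R.
Hypotheses (q0 : forall x, (0 <= q x)%R) (mq : measurable_fun setT q).
Hypothesis q1 : \int[mu]_x (q x)%:E = 1.

Lemma measurable_ratio : measurable_fun setT (fun x => q x / p0 x)%R.
Proof. by apply: measurable_funM => //; exact: measurable_funV. Qed.

(** Multiplying by [p0] restores [q] except on the zeros of [p0], where the quotient is 0 by
    convention; the mass of [q] lying there is lost, hence an inequality. *)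
Lemma integral_ratio_le1 : \int[P0]_x (q x / p0 x)%:E <= 1.
Proof.
rewrite integral_density; last by apply/measurable_EFinP; exact: measurable_ratio.
rewrite -q1; apply: ge0_le_integral => //.
- by move=> x _; rewrite -EFinM lee_fin mulr_ge0// divr_ge0.
- apply: emeasurable_funM; apply/measurable_EFinP => //; exact: measurable_ratio.
- exact/measurable_EFinP.
- move=> x _; rewrite -EFinM lee_fin; have [->|px] := eqVneq (p0 x) 0%R.
    by rewrite mul0r.
  by rewrite mulrC divfK.
Qed.

Variable alpha : R.
Hypothesis a01 : (0 < alpha < 1)%R.

(** At the zeros of [p0] both integrands vanish because [1 - alpha] is nonzero; elsewhere the
    exponents of [p0] add up. *)
Lemma affinityE : \int[mu]_x (q x `^ alpha * p0 x `^ (1 - alpha))%:E =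
  \int[P0]_x ((q x / p0 x) `^ alpha)%:E.
Proof.
have /andP[a0 a1] := a01.
rewrite integral_density; last first.
  apply/measurable_EFinP; apply: (measurableT_comp (measurable_powR alpha)).
  exact: measurable_ratio.
apply: eq_integral => x _; rewrite -EFinM; congr EFin.
rewrite powRM ?invr_ge0// -(powR_inv1 (p00 x)) -powRrM mulN1r.
have [->|px] := eqVneq (p0 x) 0%R.
  by rewrite powR0 ?mul0r ?mulr0// subr_eq0 gt_eqF.
by rewrite powRD ?px ?implybT// powRr1// mulrCA.
Qed.

Lemma affinity_ge0 : 0 <= \int[mu]_x (q x `^ alpha * p0 x `^ (1 - alpha))%:E.
Proof. by apply: integral_ge0 => x _; rewrite lee_fin mulr_ge0 ?powR_ge0. Qed.

(** The affine bound [powR_le_affine] for the ratio is integrated against [P0]; the result is at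
    most [alpha + (1 - alpha)]. *)
Lemma affinity_le1 : \int[mu]_x (q x `^ alpha * p0 x `^ (1 - alpha))%:E <= 1.
Proof.
have /andP[a0 a1] := a01.
have mr := measurable_ratio.
have r0 x : (0 <= q x / p0 x)%R by rewrite divr_ge0.
rewrite affinityE.
apply: (@le_trans _ _ (\int[P0]_x (alpha%:E * (q x / p0 x)%:E + (1 - alpha)%:E))).
  apply: ge0_le_integral => //.
  - by move=> x _; rewrite lee_fin powR_ge0.
  - apply/measurable_EFinP.
    exact: (measurableT_comp (measurable_powR alpha)).
  - apply: emeasurable_funD => //; apply: emeasurable_funM => //.
    exact/measurable_EFinP.
  - by move=> x _; rewrite lee_fin powR_le_affine.
rewrite ge0_integralD//; last 3 first.
- by move=> x _; rewrite -EFinM lee_fin mulr_ge0// ltW.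
- by apply: emeasurable_funM => //; exact/measurable_EFinP.
- by move=> x _; rewrite lee_fin subr_ge0 ltW.
rewrite ge0_integralZl//; last 3 first.
- exact/measurable_EFinP.
- by move=> x _; rewrite lee_fin.
- by rewrite lee_fin ltW.
rewrite integral_cst// [X in _ + _ * X](probability_setT P0) mule1.
have -> : 1%E = alpha%:E * 1 + (1 - alpha)%:E :> \bar R.
  by rewrite mule1 -EFinD subrKC.
by rewrite leeD2r// lee_wpmul2l ?integral_ratio_le1// lee_fin ltW.
Qed.

Lemma affinity_fin_num :
  \int[mu]_x (q x `^ alpha * p0 x `^ (1 - alpha))%:E \is a fin_num.
Proof.
rewrite ge0_fin_numE ?affinity_ge0//.
by rewrite (le_lt_trans affinity_le1)// ltry.
Qed.

Lemma Dalpha_ge0 : 0 <= Dalpha mu alpha q p0.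
Proof.
have /andP[a0 a1] := a01.
rewrite /Dalpha; case: ifPn => // _.
rewrite lee_fin ler_ndivlMr ?subr_lt0// mul0r ln_le0//.
by rewrite -lee_fin fineK ?affinity_fin_num// affinity_le1.
Qed.

End other.
End density.

(** * The tempered likelihood ratio and its normalisation *)

Section tempered_weight.
Context {R : realType} {d dT dO : measure_display}.
Context {TX : measurableType d} {Th : measurableType dT}.
Context {Omega : measurableType dO}.
Variables (mu : {measure set TX -> \bar R}) (P0 : probability TX R).
Variable p0 : TX -> R.
Hypotheses (p00 : forall x, (0 <= p0 x)%R) (mp0 : measurable_fun setT p0).
Hypothesis P0E : forall A, measurable A -> P0 A = \int[mu]_(x in A) (p0 x)%:E.
Variable dens : Th -> TX -> R.
Hypothesis dens0 : forall th x, (0 <= dens th x)%R.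
Hypothesis mdens : measurable_fun setT (fun z : Th * TX => dens z.1 z.2).
Hypothesis dens1 : forall th, \int[mu]_x (dens th x)%:E = 1.
Variable alpha : R.
Hypothesis a01 : (0 < alpha < 1)%R.
Variables (Pr : probability Omega R) (n : nat) (X : 'I_n -> Omega -> TX).
Hypotheses (n0 : (0 < n)%N) (iidX : iid_sample Pr X P0).

Definition affinity th : \bar R :=
  \int[mu]_x (dens th x `^ alpha * p0 x `^ (1 - alpha))%:E.

(* [affinity th ^- n], with value +oo where the affinity vanishes *)
Definition tilt th : \bar R :=
  if affinity th == 0 then +oo else ((fine (affinity th)) ^- n)%:E.

(** This is [W_K] for a single model: [tilt] equals exp(n (1 - alpha) D_alpha), both being infinite
    when the affinity vanishes. *)
Definition tempered_weight w th : \bar R :=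
  (\prod_(i < n) (dens th (X i w) / p0 (X i w)) `^ alpha)%:E * tilt th.

Lemma measurable_dens th : measurable_fun setT (dens th).
Proof. exact: (measurableT_comp mdens (pair1_measurable th)). Qed.

Lemma measurable_densr x : measurable_fun setT (fun th => dens th x).
Proof. exact: (measurableT_comp mdens (pair2_measurable x)). Qed.

Let mX i : measurable_fun setT (X i). Proof. by case: iidX. Qed.

Lemma measurable_joint_ratio d' (S : measurableType d') (f : S -> Th)
    (g : S -> TX) : measurable_fun setT f -> measurable_fun setT g ->
  measurable_fun setT (fun s => (dens (f s) (g s) / p0 (g s)) `^ alpha)%R.
Proof.
move=> mf mg; apply: (measurableT_comp (measurable_powR alpha)).
apply: measurable_funM.
  exact: (measurableT_comp mdens (measurable_fun_pair mf mg)).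
by apply: measurable_funV; exact: measurableT_comp.
Qed.

(** As [mu] is an arbitrary measure, the affinity is first rewritten as an integral against the
    probability [P0], for which Tonelli's theorem gives measurability in the parameter. *)
Lemma measurable_affinity : measurable_fun setT affinity.
Proof.
rewrite (_ : affinity = fubini_F P0
    (fun z => ((dens z.1 z.2 / p0 z.2) `^ alpha)%:E)); last first.
  apply/funext => th; rewrite /affinity /fubini_F (@affinityE _ _ _ _ P0)//.
  exact: measurable_dens.
apply: measurable_fun_fubini_tonelli_F.
  apply/measurable_EFinP; apply: measurable_joint_ratio.
    exact: measurable_fst.
  exact: measurable_snd.
by move=> z; rewrite lee_fin powR_ge0.
Qed.

Let aff_fin th : affinity th \is a fin_num.
Proof. by apply: (@affinity_fin_num _ _ _ _ P0) => //; exact: measurable_dens. Qed.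

Let aff_ge0 th : 0 <= affinity th.
Proof. exact: affinity_ge0. Qed.

Lemma DalphaE th : Dalpha mu alpha (dens th) p0 =
  if affinity th == 0 then +oo else (ln (fine (affinity th)) / (alpha - 1))%:E.
Proof. by []. Qed.

Lemma measurable_Dalpha :
  measurable_fun setT (fun th => Dalpha mu alpha (dens th) p0).
Proof.
under eq_fun do rewrite DalphaE.
apply: measurable_fun_ifT => //.
  by apply: measurable_fun_eqe => //; exact: measurable_affinity.
apply/measurable_EFinP; apply: measurable_funM => //.
apply: measurableT_comp; first exact: measurable_ln.
by apply: measurableT_comp => //; exact: measurable_affinity.
Qed.

Lemma tilt_ge0 th : 0 <= tilt th.
Proof.
by rewrite /tilt; case: ifPn => // _; rewrite lee_fin invr_ge0 exprn_ge0// fine_ge0.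
Qed.

Lemma measurable_tilt : measurable_fun setT tilt.
Proof.
apply: measurable_fun_ifT => //.
  by apply: measurable_fun_eqe => //; exact: measurable_affinity.
apply/measurable_EFinP; apply: measurable_funV; apply: measurable_funX.
by apply: measurableT_comp => //; exact: measurable_affinity.
Qed.

Lemma tempered_weight_ge0 w th : 0 <= tempered_weight w th.
Proof.
rewrite mule_ge0 ?tilt_ge0// lee_fin; apply: prodr_ge0 => i _; exact: powR_ge0.
Qed.

Lemma measurable_tempered_weight :
  measurable_fun setT (fun z : Omega * Th => tempered_weight z.1 z.2).
Proof.
apply: emeasurable_funM.
  apply/measurable_EFinP; apply: measurable_prod => i _.
  apply: measurable_joint_ratio; first exact: measurable_snd.
  by apply: measurableT_comp => //; exact: measurable_fst.
by apply: (measurableT_comp measurable_tilt); exact: measurable_snd.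
Qed.

(** By independence the product has expectation [affinity th ^+ n], which [tilt] cancels. If the
    affinity is 0, then [n > 0] makes this power 0 and the convention [0 * +oo = 0] makes the
    expectation 0. *)
Lemma expectation_tempered_weight th : \int[Pr]_w tempered_weight w th <= 1.
Proof.
have mr : measurable_fun setT (fun x => (dens th x / p0 x) `^ alpha)%R.
  exact: measurable_joint_ratio.
have ->: \int[Pr]_w tempered_weight w th = (fine (affinity th) ^+ n)%:E * tilt th.
  rewrite ge0_integralZr//.
  - rewrite (@iid_integral_prod _ _ _ _ _ _ _ X P0 iidX
      (fun x => (dens th x / p0 x) `^ alpha)%R (fine (affinity th)))//.
      by move=> x; exact: powR_ge0.
    rewrite fineK// /affinity (@affinityE _ _ _ _ P0)//.
    exact: measurable_dens.
  - apply/measurable_EFinP; apply: measurable_prod => i _.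
    by apply: (measurableT_comp mr).
  - by move=> w _; rewrite lee_fin; apply: prodr_ge0 => i _; exact: powR_ge0.
  - exact: tilt_ge0.
rewrite /tilt; case: ifPn => [/eqP ->|h0]; first by rewrite expr0n eqn0Ngt n0 mul0e.
rewrite -EFinM divff// expf_eq0 n0 /= fine_eq0//.
Qed.

Lemma measurable_integral_tempered_weight (Pi : probability Th R) :
  measurable_fun setT (fun w => \int[Pi]_th tempered_weight w th).
Proof.
apply: (@measurable_fun_fubini_tonelli_F _ _ _ _ _ Pi
  (fun z => tempered_weight z.1 z.2)).
  exact: measurable_tempered_weight.
by move=> z; exact: tempered_weight_ge0.
Qed.

Lemma expectation_integral_tempered_weight (Pi : probability Th R) :
  \int[Pr]_w \int[Pi]_th tempered_weight w th <= 1.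
Proof.
rewrite (@fubini_tonelli _ _ _ _ _ Pr Pi (fun z => tempered_weight z.1 z.2))//=; last 2 first.
- exact: measurable_tempered_weight.
- by move=> z; exact: tempered_weight_ge0.
apply: (@le_trans _ _ (\int[Pi]_th cst 1 th)).
  apply: ge0_le_integral => //.
  - by move=> th _; apply: integral_ge0 => w _; exact: tempered_weight_ge0.
  - apply: (@measurable_fun_fubini_tonelli_G _ _ _ _ _ Pr
      (fun z => tempered_weight z.1 z.2)).
      exact: measurable_tempered_weight.
    by move=> z; exact: tempered_weight_ge0.
  - by move=> th _; exact: expectation_tempered_weight.
by rewrite integral_cst// mul1e probability_le1.
Qed.

(** A log-likelihood above [-oo] makes the density positive at each observation, hence the product
    positive; a finite weight then excludes a zero affinity, so all logarithms are genuine. The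
    exponential form is the one [variational_bound] takes as input. *)
Lemma tempered_weight_expR w th : (forall i, (0 < p0 (X i w))%R) ->
  -oo < loglik dens (fun i => X i w) th -> tempered_weight w th < +oo ->
  Dalpha mu alpha (dens th) p0 < +oo /\
  tempered_weight w th = (expR (alpha * fine (loglik dens (fun i => X i w) th)
    - alpha * (\sum_(i < n) ln (p0 (X i w)))
    + (n%:R * (1 - alpha)) * fine (Dalpha mu alpha (dens th) p0)))%:E.
Proof.
have /andP[a0 a1] := a01.
move=> p0X lgt Wlt.
have dX i : (0 < dens th (X i w))%R.
  rewrite ltNge; apply/negP => di; move: lgt; rewrite /loglik (bigD1 i)//=.
  have -> : elog (dens th (X i w)) = -oo by rewrite /elog ltNge di.
  by rewrite addNye ltxx.
have pr0 i : (0 < (dens th (X i w) / p0 (X i w)) `^ alpha)%R.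
  by rewrite powR_gt0// divr_gt0.
have prod0 : (0 < \prod_(i < n) (dens th (X i w) / p0 (X i w)) `^ alpha)%R.
  exact: prodr_gt0.
have h0 : affinity th != 0.
  apply/negP => h0; move: Wlt; rewrite /tempered_weight /tilt h0.
  by rewrite mulry gtr0_sg// mul1e ltxx.
have h1 : (0 < fine (affinity th))%R.
  by rewrite lt_neqAle fine_ge0// andbT eq_sym fine_eq0.
rewrite DalphaE (negbTE h0); split; first exact: ltry.
rewrite /tempered_weight /tilt (negbTE h0) -EFinM; congr EFin.
have -> : loglik dens (fun i => X i w) th = (\sum_(i < n) ln (dens th (X i w)))%:E.
  by rewrite /loglik -sumEFin; apply: eq_bigr => i _; rewrite /elog dX.
rewrite /= -mulrBr -sumrB.
have -> : (n%:R * (1 - alpha) * (ln (fine (affinity th)) / (alpha - 1)) =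
    - (ln (fine (affinity th)) *+ n))%R.
  rewrite -mulr_natl; field.
  by rewrite subr_eq0 lt_eqF.
rewrite -lnXn// expRD expRN lnK ?posrE ?exprn_gt0//; congr (_ * _)%R.
rewrite mulr_sumr expR_sum; apply: eq_bigr => i _.
by rewrite -ln_div ?posrE// /powR gt_eqF ?divr_gt0.
Qed.

Lemma measurable_loglik (xs : 'I_n -> TX) : measurable_fun setT (loglik dens xs).
Proof.
rewrite /loglik; apply: emeasurable_sum => i.
apply: measurableT_comp; first exact: measurable_elog.
exact: measurable_densr.
Qed.

End tempered_weight.

(** Being almost everywhere above [f >= 0], the function [g] agrees almost everywhere with its
    positive part, and the comparison of nonnegative functions applies. *)
Lemma ae_le_integral_ge0 d (T : measurableType d) (R : realType)
    (m : {measure set T -> \bar R}) (f g : T -> \bar R) :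
  measurable_fun setT f -> (forall x, 0 <= f x) -> m.-integrable setT g ->
  {ae m, forall x, f x <= g x} -> \int[m]_x f x <= \int[m]_x g x.
Proof.
move=> mf f0 ig fg.
have mg : measurable_fun setT g by exact: measurable_int ig.
have mgp : measurable_fun setT g^\+ by exact: measurable_funepos.
have -> : \int[m]_x g x = \int[m]_x g^\+ x.
  apply: ae_eq_integral => //.
  apply: filterS fg => x fgx _; rewrite funeposE.
  by apply/esym/max_idPl; exact: le_trans (f0 x) fgx.
apply: ae_ge0_le_integral => //.
by apply: filterS fg => x fgx _; rewrite funeposE le_max fgx.
Qed.

Lemma ln_le_subr1 (R : realType) (x : R) : (0 < x)%R -> (ln x <= x - 1)%R.
Proof.
move=> x0; have := @le_ln1Dx R (x - 1)%R; rewrite subrKC; apply.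
by rewrite ltrBrDr addNr.
Qed.

(** * Densities of [rho] and the variational inequality *)

Section variational.
Context {R : realType} {d : measure_display} {T : measurableType d}.
Variables (rho Pi : probability T R).

(** The sigma-finite version of the derivative is nonnegative and finite everywhere. It agrees with
    the one in [KLm] almost everywhere for [Pi], hence for [rho] by domination. *)
Lemma KLm_density : rho `<< Pi -> exists f : T -> R,
  [/\ forall t, (0 <= f t)%R, measurable_fun setT f,
      forall A, measurable A -> rho A = \int[Pi]_(t in A) (f t)%:E &
      KLm rho Pi = \int[rho]_t (ln (f t))%:E].
Proof.
move=> rP; pose g := Radon_Nikodym_SigmaFinite.f rho Pi.
have g0 t : 0 <= g t by exact: Radon_Nikodym_SigmaFinite.f_ge0.
have gfin t : g t \is a fin_num by exact: Radon_Nikodym_SigmaFinite.f_fin_num.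
have mg : measurable_fun setT g.
  by apply: (measurable_int Pi); exact: Radon_Nikodym_SigmaFinite.f_integrable.
have mRN : measurable_fun setT (Radon_Nikodym (charge_of_finite_measure rho) Pi).
  by apply: (measurable_int Pi); exact: Radon_Nikodym_integrable.
have mlnfine (h : T -> \bar R) : measurable_fun setT h ->
    measurable_fun setT (fun t => (ln (fine (h t)))%:E).
  move=> mh; apply/measurable_EFinP.
  apply: measurableT_comp; first exact: measurable_ln.
  exact: measurableT_comp.
exists (fine \o g); split.
- by move=> t /=; exact: fine_ge0.
- exact: measurableT_comp.
- move=> A mA; rewrite (Radon_Nikodym_SigmaFinite.f_integral rP)//.
  by apply: eq_integral => t _; rewrite /= fineK.
- rewrite /KLm; case: pselect => // rP'.
  apply: ae_eq_integral => //; [exact: mlnfine|exact: mlnfine|].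
  have : ae_eq rho setT g (Radon_Nikodym (charge_of_finite_measure rho) Pi).
    apply: (null_dominates_ae_eq measurableT rP).
    exact: ae_eq_Radon_Nikodym_SigmaFinite.
  by apply: filterS => t + _ => /(_ I) /= ->.
Qed.

Section inverse_density.
Variable f : T -> R.
Hypotheses (f0 : forall t, (0 <= f t)%R) (mf : measurable_fun setT f).
Hypothesis rhoE : forall A, measurable A -> rho A = \int[Pi]_(t in A) (f t)%:E.

(** The density cancels its inverse except on its zeros, where the left-hand integrand vanishes. *)
Lemma integral_inv_density (g : T -> \bar R) : (forall t, 0 <= g t) ->
  measurable_fun setT g ->
  \int[rho]_t ((f t)^-1%:E * g t) <= \int[Pi]_t g t.
Proof.
move=> g0 mg.
have mfg : measurable_fun setT (fun t => (f t)^-1%:E * g t).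
  apply: emeasurable_funM => //; apply/measurable_EFinP.
  exact: measurable_funV.
rewrite (@integral_density _ _ _ Pi rho f)//; apply: ge0_le_integral => //.
- by move=> t _; rewrite muleA mule_ge0// -EFinM lee_fin mulr_ge0// invr_ge0.
- by apply: emeasurable_funM => //; exact/measurable_EFinP.
- move=> t _; rewrite muleA -EFinM; have [->|ft] := eqVneq (f t) 0%R.
    by rewrite mul0r mul0e.
  by rewrite divff// mul1e.
Qed.

(** [- ln f = ln f^-1 <= f^-1] wherever [f] is positive, and [f^-1] has [rho]-integral at most 1. A
    finite divergence thus makes [ln f] integrable. *)
Lemma ln_density_neg_lty : \int[rho]_t (fun t => (ln (f t))%:E)^\- t < +oo.
Proof.
have mlf : measurable_fun setT (fun t => (ln (f t))%:E).
  apply/measurable_EFinP; apply: measurableT_comp => //; exact: measurable_ln.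
apply: (@le_lt_trans _ _ (\int[rho]_t ((f t)^-1%:E * cst 1 t))).
  apply: ae_ge0_le_integral => //.
  - exact: measurable_funeneg.
  - by move=> t _; rewrite mule1 lee_fin invr_ge0.
  - apply: emeasurable_funM => //; apply/measurable_EFinP.
    exact: measurable_funV.
  - apply: filterS (ae_density_gt0 Pi rho f f0 mf rhoE) => t ft _.
    rewrite mule1 funenegE ge_max -EFinN !lee_fin invr_ge0 (ltW ft) andbT.
    rewrite -lnV ?posrE// (le_trans (ln_le_subr1 _ _ _))// ?invr_gt0//.
    by rewrite gerBl.
apply: le_lt_trans (integral_inv_density (cst 1) _ _) _ => //.
by rewrite integral_cst// mul1e (le_lt_trans (probability_le1 _ _))// ltry.
Qed.

End inverse_density.

(* Here [L] is a log-likelihood, [W] a tempered likelihood ratio and [D] a divergence;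
   the hypothesis on the objective excludes the junk value -oo of oo - oo. *)
Lemma variational_bound (L D W : T -> \bar R) (alpha cc w kap : R) :
  measurable_fun setT L -> measurable_fun setT D -> measurable_fun setT W ->
  (forall t, 0 <= D t) -> (forall t, 0 <= W t) -> (forall t, L t < +oo) ->
  (0 < alpha)%R -> (0 < w)%R -> (0 <= kap)%R ->
  (forall t, -oo < L t -> W t < +oo -> D t < +oo /\
    W t = (expR (alpha * fine (L t) - cc + kap * fine (D t)))%:E) ->
  -oo < alpha%:E * \int[rho]_t L t - KLm rho Pi ->
  kap%:E * \int[rho]_t D t +
    (alpha%:E * \int[rho]_t L t - KLm rho Pi - (ln w^-1)%:E) <=
  (cc - 1)%:E + w%:E * \int[Pi]_t W t.
Proof.
move=> mL mD mW D0 W0 Ly a0 w0 k0 HW elbo.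
have [->|Wfin] := pselect (\int[Pi]_t W t = +oo).
  by rewrite gt0_muley ?lte_fin// addey// leey.
have {}Wfin : \int[Pi]_t W t < +oo by rewrite ltey; exact/eqP.
have KLy : KLm rho Pi < +oo.
  by rewrite ltey; apply/eqP => K; rewrite K addeNy in elbo.
have rP : rho `<< Pi by move: KLy; rewrite /KLm; case: pselect.
have [f [f0 mf fA KLE]] := KLm_density rP.
have LNy : -oo < \int[rho]_t L t.
  rewrite ltNye; apply/eqP => K; move: elbo.
  by rewrite K gt0_muleNy ?lte_fin// addNye.
have Ln : \int[rho]_t L^\- t < +oo by exact: integral_neg_lty.
have f_gt0 := ae_density_gt0 Pi rho f f0 mf fA.
have mlf : measurable_fun setT (fun t => (ln (f t))%:E).
  apply/measurable_EFinP; apply: measurableT_comp => //; exact: measurable_ln.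
have ilf : rho.-integrable setT (fun t => (ln (f t))%:E).
  apply: integrable_neg_lty => //; first exact: ln_density_neg_lty.
  by rewrite -KLE.
pose e t := (f t)^-1%:E * W t.
have me : measurable_fun setT e.
  apply: emeasurable_funM => //; apply/measurable_EFinP.
  exact: measurable_funV.
have e0 t : 0 <= e t by rewrite mule_ge0// lee_fin invr_ge0.
have eW : \int[rho]_t e t <= \int[Pi]_t W t by exact: integral_inv_density.
have ie : rho.-integrable setT e.
  apply/integrableP; split => //.
  under eq_integral do rewrite gee0_abs//.
  exact: le_lt_trans eW _.
(* [b] is the upper bound on [alpha * L + kap * D] obtained by solving [ln y <= y - 1] at
   [y = w * e], where [ln W] is [alpha * L - cc + kap * D]. *)
pose c1 := (- ln w - 1 + cc)%R.
pose b t := (ln (f t))%:E + (w%:E * e t + c1%:E).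
have ic r : rho.-integrable setT (fun=> r%:E).
  by apply: finite_measure_integrable_cst.
have iwe : rho.-integrable setT (fun t => w%:E * e t) by exact: integrableZl.
have ib : rho.-integrable setT b by apply: integrableD => //; exact: integrableD.
have bE : \int[rho]_t b t = KLm rho Pi + (w%:E * \int[rho]_t e t + c1%:E).
  rewrite integralD//; last exact: integrableD.
  rewrite KLE; congr (_ + _); rewrite integralD// integralZl//; congr (_ + _).
  by rewrite integral_cst// [X in _ * X](probability_setT rho) mule1.
have L_gt : {ae rho, forall t, -oo < L t}.
  have iLn : rho.-integrable setT L^\-.
    apply/integrableP; split; first exact: measurable_funeneg.
    by under eq_integral do rewrite gee0_abs//.
  apply: filterS (integrable_ae measurableT iLn) => t /(_ I).
  by rewrite funenegE; case: (L t) => [r _||]//=; rewrite ltNyr.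
have e_fin := integrable_ae measurableT ie.
have key : {ae rho, forall t, [/\ L t \is a fin_num, D t \is a fin_num &
    alpha%:E * L t + kap%:E * D t <= b t]}.
  near=> t.
  have Lt : -oo < L t by near: t.
  have ft : (0 < f t)%R by near: t.
  have et : e t \is a fin_num by apply: (near e_fin t) => //.
  (* Finiteness of [e t] with [f t > 0] forces that of [W t], which gives access to the exponential
     form in [HW]. *)
  have Wt : W t < +oo.
    rewrite ltey; apply/eqP => WE; move: et.
    by rewrite /e WE gt0_muley// lte_fin invr_gt0.
  have [Dt WE] := HW t Lt Wt.
  have Lf : L t \is a fin_num by rewrite fin_numE -ltNye Lt -ltey Ly.
  have Df : D t \is a fin_num by rewrite ge0_fin_numE.
  split=> //; rewrite /b /e WE -(fineK Lf) -(fineK Df) /=.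
  rewrite -!EFinM -!EFinD lee_fin /c1.
  set h := (alpha * fine (L t) - cc + kap * fine (D t))%R.
  have x0 : (0 < w * ((f t)^-1 * expR h))%R.
    by rewrite !mulr_gt0// ?invr_gt0// expR_gt0.
  have := ln_le_subr1 _ _ x0.
  rewrite lnM ?posrE// ?mulr_gt0// ?invr_gt0 ?expR_gt0//.
  rewrite lnM ?posrE// ?mulr_gt0// ?invr_gt0 ?expR_gt0//.
  rewrite lnV ?posrE// expRK {1}/h.
  set y := (w * _)%R; lra.
(* The negative part is already controlled; as [kap * D >= 0], the bound [b] also dominates
   [alpha * L] and controls the positive part. *)
have iL : rho.-integrable setT L.
  apply: integrable_posneg_lty => //.
  have ib' : rho.-integrable setT (fun t => alpha^-1%:E * b t).
    exact: integrableZl.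
  have hb : \int[rho]_t (fun t => alpha^-1%:E * b t)^\+ t < +oo.
    exact: integral_funepos_lt_pinfty.
  apply: le_lt_trans hb.
  apply: ae_ge0_le_integral => //.
  - exact: measurable_funepos.
  - by apply: measurable_funepos; exact: measurable_int ib'.
  - apply: filterS key => t [Lf Df Lb] _.
    have Lb' : L t <= alpha^-1%:E * b t.
      rewrite lee_pdivlMl// (le_trans _ Lb)// leeDl// mule_ge0//.
    by rewrite !funeposE ge_max !le_max lexx orbT andbT Lb'.
have ii : rho.-integrable setT (fun t => b t - alpha%:E * L t).
  by apply: integrableB => //; exact: integrableZl.
(* [D] is only known to be nonnegative, so it is isolated on the left, below an integrable
   function. *)
have ineq : kap%:E * \int[rho]_t D t <= \int[rho]_t b t - alpha%:E * \int[rho]_t L t.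
  rewrite -ge0_integralZl// -integralZl//.
  rewrite -integralB//; last exact: integrableZl.
  apply: ae_le_integral_ge0 => //.
  - exact: emeasurable_funM.
  - by move=> t; rewrite mule_ge0// lee_fin.
  - apply: filterS key => t [Lf Df]; rewrite addeC -leeBrDr//.
    by rewrite fin_numM.
have Lfin : \int[rho]_t L t \is a fin_num by exact: integrable_fin_num.
have KLfin : KLm rho Pi \is a fin_num by rewrite KLE; exact: integrable_fin_num.
have efin : \int[rho]_t e t \is a fin_num by exact: integrable_fin_num.
have WIfin : \int[Pi]_t W t \is a fin_num.
  by rewrite ge0_fin_numE//; exact: integral_ge0.
have lnwV : (ln w^-1 = - ln w)%R by rewrite lnV.
rewrite -leeBrDr; last first.
  by rewrite !fin_numB KLfin fin_numM.
apply: (le_trans ineq); rewrite bE lnwV.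
move: eW; rewrite -(fineK Lfin) -(fineK KLfin) -(fineK efin) -(fineK WIfin).
rewrite -!EFinM -!EFinN -!EFinD !lee_fin => eW.
have : (w * fine (\int[rho]_t e t) <= w * fine (\int[Pi]_t W t))%R.
  by rewrite ler_pM2l.
by rewrite /c1; lra.
Unshelve. all: by end_near.
Qed.

End variational.

(** * Averaged log-ratios and the exchange of integrals *)

Section oracle.
Context {R : realType} {d dT : measure_display}.
Context {TX : measurableType d} {Th : measurableType dT}.
Variables (mu : {measure set TX -> \bar R}) (P0 : probability TX R).
Variable p0 : TX -> R.
Hypotheses (p00 : forall x, (0 <= p0 x)%R) (mp0 : measurable_fun setT p0).
Hypothesis P0E : forall A, measurable A -> P0 A = \int[mu]_(x in A) (p0 x)%:E.
Variable qs : TX -> R.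
Hypotheses (qs0 : forall x, (0 <= qs x)%R) (mqs : measurable_fun setT qs).
Hypothesis qs1 : \int[mu]_x (qs x)%:E = 1.
Hypothesis KLfin : KLdens mu p0 qs < +oo.

Let k x : R := (ln (p0 x) - ln (qs x))%R.

Let mk : measurable_fun setT k.
Proof.
by apply: measurable_funB; apply: measurableT_comp => //; exact: measurable_ln.
Qed.

Let p0_gt0 : {ae P0, forall x, (0 < p0 x)%R}.
Proof. exact: (ae_density_gt0 mu). Qed.

(** A finite divergence includes absolute continuity, applied here to the zero set of [qs]. *)
Lemma ae_KLdens_gt0 : {ae P0, forall x, (0 < qs x)%R}.
Proof.
have ac : dens_abs_cont mu p0 qs by move: KLfin; rewrite /KLdens; case: pselect.
have mN : measurable [set x | qs x = 0%R].
  by rewrite -[X in measurable X]setTI;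
    exact: (mqs measurableT [set 0%R] (measurable_set1 0%R)).
exists [set x | qs x = 0%R]; split => //.
  by rewrite /= P0E// ac//; apply: integral0_eq => x /= ->.
by move=> x /= /negP; rewrite -leNgt => qx; apply/le_anti; rewrite qx qs0.
Qed.

Lemma KLdensE : KLdens mu p0 qs = \int[P0]_x (k x)%:E.
Proof.
rewrite /KLdens; case: pselect => [ac|nac]; last first.
  by move: KLfin; rewrite /KLdens; case: pselect.
have me : measurable_fun setT (fun x => elog (p0 x / qs x)).
  apply: measurableT_comp; first exact: measurable_elog.
  by apply: measurable_funM => //; exact: measurable_funV.
rewrite -(integral_density mu P0 p0)//; apply: ae_eq_integral => //.
  exact/measurable_EFinP.
near=> x => _.
have px : (0 < p0 x)%R by near: x.
have qx : (0 < qs x)%R by near: x; exact: ae_KLdens_gt0.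
by rewrite /elog divr_gt0// ln_div.
Unshelve. all: by end_near.
Qed.

Lemma integrable_log_ratio : P0.-integrable setT (fun x => (k x)%:E).
Proof.
have mke : measurable_fun setT (fun x => (k x)%:E) by exact/measurable_EFinP.
apply: integrable_neg_lty => //; last by rewrite -KLdensE.
have r1 := integral_ratio_le1 mu P0 p0 p00 mp0 P0E qs qs0 mqs qs1.
apply: le_lt_trans (le_lt_trans r1 (ltry 1)).
apply: ae_ge0_le_integral => //.
- exact: measurable_funeneg.
- by move=> x _; rewrite lee_fin divr_ge0.
- by apply/measurable_EFinP; exact: measurable_ratio.
- near=> x => _.
  have px : (0 < p0 x)%R by near: x.
  have qx : (0 < qs x)%R by near: x; exact: ae_KLdens_gt0.
  rewrite funenegE ge_max -EFinN !lee_fin divr_ge0// andbT /k opprB.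
  by rewrite -ln_div// (le_trans (ln_le_subr1 _ _ _)) ?divr_gt0// gerBl.
Unshelve. all: by end_near.
Qed.

Variable dens : Th -> TX -> R.
Hypothesis dens0 : forall th x, (0 <= dens th x)%R.
Hypothesis mdens : measurable_fun setT (fun z : Th * TX => dens z.1 z.2).
Hypothesis dens1 : forall th, \int[mu]_x (dens th x)%:E = 1.
Variables (rho : probability Th R) (r : R).
Hypothesis rho_r :
  \int[rho]_th (\int[P0]_x (elog (qs x) - elog (dens th x))) <= r%:E.

Let u (z : TX * Th) : \bar R := elog (qs z.1) - elog (dens z.2 z.1).

Let mu_ : measurable_fun setT u.
Proof.
apply: emeasurable_funB.
  apply: measurableT_comp; first exact: measurable_elog.
  by apply: measurableT_comp => //; exact: measurable_fst.
apply: measurableT_comp; first exact: measurable_elog.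
exact: (measurableT_comp mdens
  (measurable_fun_pair measurable_snd measurable_fst)).
Qed.

Let U th : \bar R := \int[P0]_x u^\+ (x, th).
Let N th : \bar R := \int[P0]_x u^\- (x, th).

Let mup : measurable_fun setT u^\+. Proof. exact: measurable_funepos. Qed.
Let mun : measurable_fun setT u^\-. Proof. exact: measurable_funeneg. Qed.

Let mU : measurable_fun setT U.
Proof. exact: (measurable_fun_fubini_tonelli_G u^\+). Qed.

Let mN : measurable_fun setT N.
Proof. exact: (measurable_fun_fubini_tonelli_G u^\-). Qed.

Let U0 th : 0 <= U th. Proof. exact: integral_ge0. Qed.
Let N0 th : 0 <= N th. Proof. exact: integral_ge0. Qed.

Let B := \int[P0]_x `|(k x)%:E| + 1.

Let Bfin : B < +oo.
Proof.
rewrite /B lte_add_pinfty ?ltry//.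
by have /integrableP[] := integrable_log_ratio.
Qed.

(** Where [dens th x > 0], [- u] is [k + ln (dens th / p0)], at most [|k| + dens th / p0]; where the
    density is 0, [u] is [+oo] and its negative part 0. The ratio integrates to at most 1, so the
    bound is uniform in [th]. *)
Let NB th : N th <= B.
Proof.
have mke : measurable_fun setT (fun x => `|(k x)%:E|).
  by apply: measurableT_comp => //; exact/measurable_EFinP.
have md := measurable_dens _ mdens th.
have mr : measurable_fun setT (fun x => (dens th x / p0 x)%:E).
  by apply/measurable_EFinP; exact: measurable_ratio.
apply: (@le_trans _ _ (\int[P0]_x (`|(k x)%:E| + (dens th x / p0 x)%:E))).
  apply: ae_ge0_le_integral => //.
  - exact: (measurableT_comp mun (pair2_measurable th)).
  - by move=> x _; rewrite adde_ge0// lee_fin divr_ge0.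
  - exact: emeasurable_funD.
  - near=> x => _.
    have px : (0 < p0 x)%R by near: x.
    have qx : (0 < qs x)%R by near: x; exact: ae_KLdens_gt0.
    have S0 : 0 <= `|(k x)%:E| + (dens th x / p0 x)%:E.
      by rewrite adde_ge0// lee_fin divr_ge0.
    rewrite funenegE ge_max S0 andbT /u /= /elog qx.
    case: ifPn => [dx|_]; last by rewrite oppeB//= addeNy leNye.
    rewrite -EFinB -EFinN -EFinD lee_fin opprB.
    have kk : (k x <= `|k x|)%R by exact: ler_norm.
    have := ln_le_subr1 _ (dens th x / p0 x)%R (divr_gt0 dx px).
    move: kk; rewrite ln_div// /k; lra.
rewrite ge0_integralD//; last by move=> x _; rewrite lee_fin divr_ge0.
by rewrite leeD2l//; exact: (integral_ratio_le1 mu).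
Unshelve. all: by end_near.
Qed.

Let IE th : \int[P0]_x (elog (qs x) - elog (dens th x)) = U th - N th.
Proof.
rewrite integralE; congr (_ - _); apply: eq_integral => x _.
  by rewrite !funeposE.
by rewrite !funenegE.
Qed.

Let Nfin th : N th \is a fin_num.
Proof. by rewrite ge0_fin_numE//; exact: le_lt_trans (NB th) Bfin. Qed.

Let iN : rho.-integrable setT N.
Proof.
apply/integrableP; split => //.
apply: (@le_lt_trans _ _ (\int[rho]_th cst B th)).
  apply: ge0_le_integral => //; first exact: measurableT_comp.
  by move=> th _; rewrite gee0_abs.
rewrite integral_cst// [X in _ * X](probability_setT rho) mule1//.
Qed.

(** The negative part of [U - N] is at most [N], and its integral is at most [r]; so [U - N] is
    integrable, and adding [N] back gives [U]. *)
Let iU : rho.-integrable setT U.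
Proof.
have iI : rho.-integrable setT (U \- N).
  apply: integrable_neg_lty.
  - exact: emeasurable_funB.
  - apply: le_lt_trans (_ : \int[rho]_th N th < +oo).
      apply: ge0_le_integral => //.
        by apply: measurable_funeneg; exact: emeasurable_funB.
      move=> th _; rewrite funenegE ge_max N0 andbT fin_num_oppeB//.
      by rewrite addeC geeDl// oppe_le0.
    have /integrableP[_] := iN; apply: le_lt_trans.
    by apply: ge0_le_integral => //; [exact: measurableT_comp|move=> th _; exact: lee_abs].
  - apply: le_lt_trans (le_lt_trans rho_r (ltry r)).
    by under [leRHS]eq_integral do rewrite IE.
apply: eq_integrable (integrableD measurableT iI iN) => //.
by move=> th _ /=; rewrite subeK.
Qed.

(** The section of [|u|] at [th] integrates to [U th + N th]. Joint integrability licenses Fubini: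
    [rho_r] integrates over the data first, whereas the ELBO integrates over the parameter first. *)
Let iu : (P0 \x rho).-integrable setT u.
Proof.
apply/integrable21ltyP => //.
have /integrableP[_] := integrableD measurableT iU iN.
apply: le_lt_trans; apply: ge0_le_integral => //.
- by move=> th _; exact: integral_ge0.
- apply: (measurable_fun_fubini_tonelli_G (abse \o u)) => [|z].
    exact: measurableT_comp.
  exact: abse_ge0.
- by apply: measurableT_comp => //; exact: emeasurable_funD.
- move=> th _.
  have UN0 : 0 <= (U \+ N) th by exact: adde_ge0.
  rewrite [leRHS]gee0_abs//= /U /N -ge0_integralD//.
  + rewrite le_eqVlt; apply/orP; left; apply/eqP; apply: eq_integral => x _.
    by rewrite -/((abse \o u) _) fune_abse.
  + exact: (measurableT_comp mup (pair2_measurable th)).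
  + exact: (measurableT_comp mun (pair2_measurable th)).
Qed.

(** [G x] is the [rho]-average of ln(p0 / p_th) at [x]: [V] averages ln(qs / p_th), and [k] adds
    ln(p0 / qs). It is made real-valued with [fine], harmless as [V] is finite almost everywhere. *)
Lemma oracle_log_ratio : exists G : TX -> R,
  [/\ P0.-integrable setT (fun x => (G x)%:E),
      \int[P0]_x (G x)%:E <= KLdens mu p0 qs + r%:E &
      {ae P0, forall x, [/\ (0 < p0 x)%R,
        rho.-integrable setT (fun th => elog (dens th x)) &
        \int[rho]_th elog (dens th x) = (ln (p0 x) - G x)%:E]}].
Proof.
pose V := fubini_F rho u.
have iV : P0.-integrable setT V by exact: integrable_fubini_F.
have mV : measurable_fun setT V by exact: measurable_int iV.
have mfV : measurable_fun setT (fun x => (fine (V x))%:E).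
  by apply/measurable_EFinP; exact: measurableT_comp.
have VE : ae_eq P0 setT (fun x => (fine (V x))%:E) V.
  by apply: filterS (integrable_ae measurableT iV) => x Vx _; rewrite fineK// Vx.
have ifV : P0.-integrable setT (fun x => (fine (V x))%:E).
  apply/integrableP; split => //.
  have /integrableP[_] := iV; apply: le_lt_trans.
  apply: ae_ge0_le_integral => //; [exact: measurableT_comp..|].
  by apply: filterS VE => x + _ => /(_ I) ->.
exists (fun x => fine (V x) + k x)%R; split.
- under eq_fun do rewrite EFinD.
  by apply: integrableD => //; exact: integrable_log_ratio.
- under eq_integral do rewrite EFinD.
  rewrite integralD//; last exact: integrable_log_ratio.
  rewrite -KLdensE addeC leeD2l//.
  rewrite (ae_eq_integral _ _ _ _ _ VE)//.
  apply: le_trans rho_r; rewrite le_eqVlt; apply/orP; left; apply/eqP.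
  by transitivity (\int[P0]_x \int[rho]_th u (x, th)) => //; rewrite Fubini.
- have Vf := integrable_ae measurableT iV.
  have iux := ae_integrable1 iu.
  near=> x.
  have px : (0 < p0 x)%R by near: x.
  have qx : (0 < qs x)%R by near: x; exact: ae_KLdens_gt0.
  have iuxx : rho.-integrable setT (fun th => u (x, th)) by near: x.
  have ic : rho.-integrable setT (fun=> (ln (qs x))%:E).
    exact: finite_measure_integrable_cst.
  (* When the density vanishes at [x], [u] is [+oo] and both sides are [-oo]. *)
  have elogE th : elog (dens th x) = (ln (qs x))%:E - u (x, th).
    rewrite /u /= {2}/elog qx /elog; case: ifP => [dx|//].
    by rewrite -!EFinB subKr.
  have Vx : V x \is a fin_num by apply: (near Vf x).
  split => //.
    by under eq_fun do rewrite elogE; apply: integrableB.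
  under eq_integral do rewrite elogE.
  rewrite integralB//.
  rewrite integral_cst// [X in _ * X](probability_setT rho) mule1.
  rewrite -[X in _ - X]/(V x) -(fineK Vx) -EFinB /k /=; congr EFin; lra.
Unshelve. all: by end_near.
Qed.

End oracle.

(** * The variational inequality for tempered likelihoods *)

Lemma loglik_lty (R : realType) d (TX : measurableType d) (Th : Type)
    (dens : Th -> TX -> R) (n : nat) (xs : 'I_n -> TX) (th : Th) :
  loglik dens xs th < +oo.
Proof.
rewrite /loglik; apply: lte_sum_pinfty => i _.
by rewrite /elog; case: ifP => _; rewrite ?ltry ?ltNyy.
Qed.

(** [variational_bound] at a fixed outcome [w], with [kap = n (1 - alpha)] and [cc] equal to [alpha]
    times the log-likelihood of [p0]. *)
Lemma elbo_tempered_bound (R : realType) (d dT dO : measure_display)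
    (TX : measurableType d) (Th : measurableType dT) (Omega : measurableType dO)
    (mu : {measure set TX -> \bar R}) (P0 : probability TX R) (p0 : TX -> R)
    (dens : Th -> TX -> R) (alpha : R) (Pr : probability Omega R) (n : nat)
    (X : 'I_n -> Omega -> TX) (rho Pi : probability Th R) (wt : R) (w : Omega) :
  (forall x, (0 <= p0 x)%R) -> measurable_fun setT p0 ->
  (forall A, measurable A -> P0 A = \int[mu]_(x in A) (p0 x)%:E) ->
  (forall th x, (0 <= dens th x)%R) ->
  measurable_fun setT (fun z : Th * TX => dens z.1 z.2) ->
  (forall th, \int[mu]_x (dens th x)%:E = 1) ->
  (0 < alpha < 1)%R -> iid_sample Pr X P0 -> (0 < wt)%R ->
  (forall i, (0 < p0 (X i w))%R) ->
  -oo < elbo_obj dens Pi alpha (fun i => X i w) rho ->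
  (n%:R * (1 - alpha))%:E * \int[rho]_th Dalpha mu alpha (dens th) p0 +
    (elbo_obj dens Pi alpha (fun i => X i w) rho - (ln wt^-1)%:E) <=
  (alpha * (\sum_(i < n) ln (p0 (X i w))) - 1)%:E +
    wt%:E * \int[Pi]_th tempered_weight mu p0 dens alpha n X w th.
Proof.
move=> p00 mp0 P0E dens0 mdens dens1 a01 iidX wt0 p0X elbo.
have /andP[a0 a1] := a01.
apply: variational_bound => //.
- exact: measurable_loglik.
- exact: (measurable_Dalpha mu P0).
- have mW : measurable_fun setT
      (fun z : Omega * Th => tempered_weight mu p0 dens alpha n X z.1 z.2).
    exact: (measurable_tempered_weight mu P0 _ _ _ _ _ _ _ _ _ Pr).
  exact: (measurableT_comp mW (pair1_measurable w)).
- move=> th; apply: (Dalpha_ge0 mu P0) => //.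
  exact: measurable_dens.
- by move=> th; exact: tempered_weight_ge0.
- by move=> th; exact: loglik_lty.
- by rewrite mulr_ge0// subr_ge0 ltW.
- by move=> th; exact: (tempered_weight_expR mu P0).
Qed.

Lemma le_mule_ereal_inf (R : realType) (S : set \bar R) (x : \bar R) (a b : R) :
  (0 < a)%R -> (forall y, S y -> x <= a%:E * y + b%:E) ->
  x <= a%:E * ereal_inf S + b%:E.
Proof.
move=> a0 H; rewrite -leeBlDr// -lee_pdivrMl//; apply: le_ereal_inf_tmp => y Sy.
by rewrite lee_pdivrMl// leeBlDr// H.
Qed.

(** * The mixture of tempered weights over all models *)

Section mixture.
Context {R : realType} {dX dO : measure_display}.
Context {TX : measurableType dX} {Omega : measurableType dO}.
Variables (mu : {measure set TX -> \bar R}) (P0 : probability TX R).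
Variable p0 : TX -> R.
Hypotheses (p00 : forall x, (0 <= p0 x)%R) (mp0 : measurable_fun setT p0).
Hypothesis P0E : forall A, measurable A -> P0 A = \int[mu]_(x in A) (p0 x)%:E.
Variables (Pr : probability Omega R) (n : nat) (X : 'I_n -> Omega -> TX).
Hypotheses (n0 : (0 < n)%N) (iidX : iid_sample Pr X P0).
Variables (dT : nat -> measure_display) (Theta : forall K, measurableType (dT K)).
Variables (dens : forall K, Theta K -> TX -> R) (piK : nat -> R).
Variables (Pi : forall K, probability (Theta K) R) (alpha : R).
Hypothesis dens0 : forall K th x, (0 <= dens K th x)%R.
Hypothesis mdens : forall K,
  measurable_fun setT (fun z : Theta K * TX => dens K z.1 z.2).
Hypothesis dens1 : forall K th, \int[mu]_x (dens K th x)%:E = 1.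
Hypotheses (pi0 : forall K, (0 < piK K)%R).
Hypothesis pi1 : \sum_(0 <= K <oo) (piK K)%:E = 1.
Hypothesis a01 : (0 < alpha < 1)%R.

Definition mixture_term K w : \bar R := (piK K)%:E *
  \int[Pi K]_th tempered_weight mu p0 (dens K) alpha n X w th.

Definition mixture w : \bar R := \sum_(0 <= K <oo) mixture_term K w.

Lemma mixture_term_ge0 K w : 0 <= mixture_term K w.
Proof.
apply: mule_ge0; first by rewrite lee_fin ltW.
by apply: integral_ge0 => th _; exact: tempered_weight_ge0.
Qed.

Let mI K : measurable_fun setT (fun w =>
  \int[Pi K]_th tempered_weight mu p0 (dens K) alpha n X w th).
Proof.
exact: (measurable_integral_tempered_weight mu P0 _ _ _ _ _ _ _ _ _ Pr).
Qed.

Lemma measurable_mixture_term K : measurable_fun setT (mixture_term K).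
Proof. exact: emeasurable_funM. Qed.

Lemma measurable_mixture : measurable_fun setT mixture.
Proof.
apply: ge0_emeasurable_sum => [k w _ _|k _]; first exact: mixture_term_ge0.
exact: measurable_mixture_term.
Qed.

(** One variable dominates every model at once, which allows the index to depend on the data, as
    [Khat w] does. *)
Lemma mixture_term_le K w : mixture_term K w <= mixture w.
Proof.
apply: le_trans (nneseries_lim_ge K.+1 _); last first.
  by move=> k _ _; exact: mixture_term_ge0.
rewrite big_nat_recr//= leeDr//; apply: sume_ge0 => k _.
exact: mixture_term_ge0.
Qed.

Lemma expectation_mixture : \int[Pr]_w mixture w <= 1.
Proof.
rewrite integral_nneseries//; last 2 first.
- exact: measurable_mixture_term.
- by move=> k w _; exact: mixture_term_ge0.
rewrite -pi1; apply: lee_nneseries => [k _ _|k _].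
  by apply: integral_ge0 => w _; exact: mixture_term_ge0.
rewrite ge0_integralZl//; last 2 first.
- move=> w _; apply: integral_ge0 => th _; exact: tempered_weight_ge0.
- by rewrite lee_fin ltW.
rewrite -[leRHS]mule1; apply: lee_wpmul2l; first by rewrite lee_fin ltW.
exact: (expectation_integral_tempered_weight mu P0).
Qed.

End mixture.

(** * The oracle inequality for the selected model *)

Theorem theorem4 (R : realType)
  (dX : measure_display) (TX : measurableType dX)
  (mu : {measure set TX -> \bar R})
  (P0 : probability TX R) (p0 : TX -> R)
  (dO : measure_display) (Omega : measurableType dO) (Pr : probability Omega R)
  (n : nat) (X : 'I_n -> Omega -> TX)
  (dT : nat -> measure_display) (Theta : forall K : nat, measurableType (dT K))
  (dens : forall K : nat, Theta K -> TX -> R)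
  (piK : nat -> R) (Pi : forall K : nat, probability (Theta K) R)
  (F : forall K : nat, set (probability (Theta K) R))
  (vapprox : forall K : nat, Omega -> probability (Theta K) R)
  (Khat : Omega -> nat)
  (r : nat -> R) (alpha : R) :
  (0 < n)%N ->
  (* P0 has density p0 w.r.t. the dominating measure mu *)
  (forall x, 0 <= p0 x)%R -> measurable_fun setT p0 ->
  (forall A, measurable A -> P0 A = \int[mu]_(x in A) (p0 x)%:E) ->
  (* each P_theta has density dens K theta w.r.t. mu *)
  (forall K th x, 0 <= dens K th x)%R ->
  (forall K, measurable_fun setT (fun z : Theta K * TX => dens K z.1 z.2)) ->
  (forall K th, \int[mu]_x (dens K th x)%:E = 1) ->
  (* X_1..X_n i.i.d. ~ P0 *)
  iid_sample Pr X P0 ->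
  (* prior weights *)
  (forall K, 0 < piK K)%R -> \sum_(0 <= K <oo) (piK K)%:E = 1 ->
  (* variational approximations: maximizers of the ELBO objective over F K *)
  (forall K w, F K (vapprox K w) /\
     (forall rho, F K rho ->
        elbo_obj (dens K) (Pi K) alpha (fun i => X i w) rho <=
        elbo_obj (dens K) (Pi K) alpha (fun i => X i w) (vapprox K w))) ->
  (* selected model: maximizer of ELBO(K) - log(1/pi_K) *)
  (forall w K,
     elbo_obj (dens K) (Pi K) alpha (fun i => X i w) (vapprox K w)
       - (ln (piK K)^-1)%:E <=
     elbo_obj (dens (Khat w)) (Pi (Khat w)) alpha (fun i => X i w)
       (vapprox (Khat w) w) - (ln (piK (Khat w))^-1)%:E) ->
  (forall K, 0 < r K)%R ->
  (0 < alpha < 1)%R ->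
  measurable_fun [set: Omega] (fun w : Omega =>
    (\int[vapprox (Khat w) w]_th Dalpha mu alpha (dens (Khat w) th) p0 : \bar R)) ->
  \int[Pr]_w (\int[vapprox (Khat w) w]_th Dalpha mu alpha (dens (Khat w) th) p0)
  <= ereal_inf [set
       (alpha / (1 - alpha))%:E *
         ereal_inf [set KLdens mu p0 (dens K ths) |
                    ths in Theta_r (dens K) P0 (Pi K) (F K) n (r K)]
       + ((1 + alpha) / (1 - alpha) * r K)%:E
       + ((ln (piK K)^-1) / (n%:R * (1 - alpha)))%:E
     | K in [set: nat]].
Proof.
move=> n0 p00 mp0 P0E dens0 mdens dens1 iidX pi0 pi1 vapproxP KhatP r0 a01 mLHS.
have /andP[a0 a1] := a01.
have a1' : (0 < 1 - alpha)%R by rewrite subr_gt0.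
have nR : (0 < n%:R :> R)%R by rewrite ltr0n.
have kap0 : (0 < n%:R * (1 - alpha))%R by rewrite mulr_gt0.
set kap : R := (n%:R * (1 - alpha))%R in kap0 *.
apply: le_ereal_inf_tmp => _ [K _ <-].
rewrite -addeA -EFinD; apply: le_mule_ereal_inf; first by rewrite divr_gt0.
move=> _ [ths [rho [Frho [rho_r KLrho]]] <-].
(* An infinite divergence makes the right-hand side [+oo]. *)
have [KLy|KLy] := leP +oo (KLdens mu p0 (dens K ths)).
  move: KLy; rewrite leye_eq => /eqP ->.
  by rewrite gt0_muley ?lte_fin ?divr_gt0// addye// leey.
have mths : measurable_fun setT (dens K ths) by exact: measurable_dens.
have [G [iG GKL aeG]] := oracle_log_ratio mu P0 p0 p00 mp0 P0E _ (dens0 K ths)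
  mths (dens1 K ths) KLy _ (dens0 K) (mdens K) (dens1 K) rho (r K) rho_r.
have KLfin : KLdens mu p0 (dens K ths) \is a fin_num.
  rewrite (KLdensE mu P0)//; apply: integrable_fin_num => //.
  exact: (integrable_log_ratio mu P0).
pose Z := mixture mu p0 n X dT Theta dens piK Pi alpha.
have mZ : measurable_fun setT Z by exact: (measurable_mixture mu P0 _ _ _ _ Pr).
have EZ : \int[Pr]_w Z w <= 1 by exact: (expectation_mixture mu P0).
have Z0 w : 0 <= Z w by apply: nneseries_ge0 => k _ _; exact: mixture_term_ge0.
have iZ : Pr.-integrable setT Z.
  apply/integrableP; split => //; under eq_integral do rewrite gee0_abs//.
  exact: le_lt_trans EZ (ltry 1).
(* [H] is the integrable majorant of [kap] times the loss: [n * r K] bounds the divergence of [rho]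
   from the prior, the logarithm is the penalty of model [K], and the -1 will cancel the expectation
   bound on [Z]. *)
pose c := (n%:R * r K + ln (piK K)^-1 - 1)%R.
pose H w := alpha%:E * (\sum_(i < n) (G (X i w))%:E) + (c%:E + Z w).
have iGX i : Pr.-integrable setT (fun w => (G (X i w))%:E).
  exact: (iid_integrable Pr n X P0 iidX i (fun x => (G x)%:E)).
have iS : Pr.-integrable setT (fun w => \sum_(i < n) (G (X i w))%:E).
  exact: integrable_sum.
have ic : Pr.-integrable setT (fun=> c%:E) by exact: finite_measure_integrable_cst.
have icZ : Pr.-integrable setT (fun w => c%:E + Z w) by exact: integrableD.
have iH : Pr.-integrable setT H by apply: integrableD => //; exact: integrableZl.
pose g := fine (\int[P0]_x (G x)%:E).
have gE : \int[P0]_x (G x)%:E = g%:E by rewrite fineK//; exact: integrable_fin_num.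
have EG i : \int[Pr]_w (G (X i w))%:E = g%:E.
  rewrite (iid_integral Pr n X P0 iidX _ (fun x => (G x)%:E))//.
  exact: measurable_int iG.
have HE : \int[Pr]_w H w = (alpha * (n%:R * g) + c)%:E + \int[Pr]_w Z w.
  rewrite integralD//; last exact: integrableZl.
  rewrite integralZl// integral_sum// integralD// integral_cst//.
  rewrite [X in _ + (_ * X + _)](probability_setT Pr) mule1.
  rewrite [in RHS]EFinD -addeA; congr (_ + _); rewrite EFinM; congr (_ * _).
  under eq_bigr do rewrite EG.
  by rewrite sumEFin sumr_const card_ord mulr_natl.
have bound : {ae Pr, forall w, kap%:E *
    \int[vapprox (Khat w) w]_th Dalpha mu alpha (dens (Khat w) th) p0 <= H w}.
  have : {ae Pr, forall w, forall i : 'I_n, [/\ (0 < p0 (X i w))%R,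
      rho.-integrable setT (fun th => elog (dens K th (X i w))) &
      \int[rho]_th elog (dens K th (X i w)) = (ln (p0 (X i w)) - G (X i w))%:E]}.
    by apply: filter_forall => i; exact: (iid_ae Pr n X P0 iidX i _ aeG).
  apply: filterS => w good.
  have p0X i : (0 < p0 (X i w))%R by have [] := good i.
  pose l := (\sum_(i < n) (ln (p0 (X i w)) - G (X i w)))%R.
  have lE : \int[rho]_th loglik (dens K) (fun i => X i w) th = l%:E.
    rewrite /loglik integral_sum//; last by move=> i; have [] := good i.
    by rewrite -sumEFin; apply: eq_bigr => i _; have [] := good i.
  (* A real lower bound for the penalised objective of the witness [rho]. Optimality of
     [vapprox K w] over [F K], then of [Khat w], carries it over to the selected approximation. *)
  pose e0 := (alpha * l - n%:R * r K - ln (piK K)^-1)%R.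
  pose elbo := elbo_obj (dens (Khat w)) (Pi (Khat w)) alpha (fun i => X i w)
       (vapprox (Khat w) w).
  have e0le : e0%:E <= elbo - (ln (piK (Khat w))^-1)%:E.
    apply: le_trans (KhatP w K); rewrite /e0 EFinB leeD2r//.
    apply: le_trans ((vapproxP K w).2 _ Frho).
    by rewrite /elbo_obj lE EFinB EFinM leeD2l// leeN2.
  (* Lying above a real number, the selected objective avoids the junk value [-oo]. *)
  have elboNy : -oo < elbo.
    rewrite ltNye; apply/eqP => elboE; move: e0le.
    by rewrite elboE addNye leeNy_eq.
  have := elbo_tempered_bound R _ _ _ _ _ _ mu P0 p0 (dens (Khat w)) alpha Pr n X
    (vapprox (Khat w) w) (Pi (Khat w)) (piK (Khat w)) w p00 mp0 P0E
    (dens0 _) (mdens _) (dens1 _) a01 iidX (pi0 _) p0X elboNy.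
  rewrite -/kap => VB.
  have {}VB := le_trans (leeD2l _ e0le) VB.
  have := mixture_term_le mu p0 n X dT Theta dens piK Pi alpha pi0 (Khat w) w.
  rewrite -/Z => /(leeD2l (alpha * (\sum_(i < n) ln (p0 (X i w))) - 1)%:E).
  move=> /(le_trans VB); rewrite -leeBrDr// => /le_trans; apply.
  rewrite /H sumEFin -EFinM addeA -EFinD addeAC -EFinB leeD2r// lee_fin.
  rewrite /e0 /c /l sumrB mulrBr; lra.
have key : kap%:E * \int[Pr]_w
    (\int[vapprox (Khat w) w]_th Dalpha mu alpha (dens (Khat w) th) p0) <=
    (alpha * (n%:R * g) + c)%:E + 1.
  have D0 w : 0 <=
      \int[vapprox (Khat w) w]_th Dalpha mu alpha (dens (Khat w) th) p0.
    apply: integral_ge0 => th _; apply: (Dalpha_ge0 mu P0) => //.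
    exact: measurable_dens.
  rewrite -ge0_integralZl//; last by rewrite lee_fin ltW.
  apply: (@le_trans _ _ (\int[Pr]_w H w)); last by rewrite HE leeD2l.
  apply: ae_le_integral_ge0 => //; first exact: emeasurable_funM.
  by move=> w; rewrite mule_ge0// lee_fin ltW.
move: key; rewrite -lee_pdivlMl// => /le_trans; apply.
move: GKL; rewrite gE -(fineK KLfin) -EFinD lee_fin => GKL.
rewrite -!EFinM -!EFinD lee_fin ler_pdivrMl//.
(* Clearing denominators exposes [1 + alpha]: [n * r K] enters once from the divergence to the prior
   and [alpha] times from the expectation of [G]. *)
have -> : (kap * (alpha / (1 - alpha) * fine (KLdens mu p0 (dens K ths)) +
     ((1 + alpha) / (1 - alpha) * r K + ln (piK K)^-1 / kap)) =
   alpha * (n%:R * fine (KLdens mu p0 (dens K ths))) + (1 + alpha) * (n%:R * r K)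
     + ln (piK K)^-1)%R.
  rewrite /kap; field.
  by rewrite gt_eqF//= gt_eqF.
have : (alpha * (n%:R * g) <=
    alpha * (n%:R * (fine (KLdens mu p0 (dens K ths)) + r K)))%R.
  by rewrite !ler_pM2l.
rewrite /c; lra.
Qed.
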